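(* Let $S_{1,n-3}$ be the tree with vertices $v_0,\dots,v_{n-1}$ and edges $e_1=\{v_0,v_1\}$, $e_2=\{v_1,v_2\}$, $e_i=\{v_2,v_i\}$ for $3\le i\le n-1$. Let $B_1=\{e_1,\dots,e_{n-1},\{v_0,v_2\},\{v_1,v_3\}\}$ and $B_2=\{e_1,\dots,e_{n-1},\{v_0,v_2\},\{v_3,v_4\}\}$. (1) If $a_0,\dots,a_{n+1}$ are the coefficients of $\det(xI-\mathfrak{D}_2(S_{1,n-3})[B_1,B_1])=\sum_{k}a_kx^k$ and $|a_t|=\max_k|a_k|$, then $\lfloor\frac{n-4}{2}\rfloor\le t\le\lceil\frac{n+4}{2}\rceil$. (2) If $b_0,\dots,b_{n+1}$ are the coefficients of $\det(xI-\mathfrak{D}_2(S_{1,n-3})[B_2,B_2])=\sum_k b_kx^k$ and $|b_t|=\max_k|b_k|$, then $\lfloor\frac{n-4}{2}\rfloor\le t\le\lceil\frac{n+4}{2}\rceil$.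
   Context: For a tree $T$, let $\mathcal{V}_2$ be the set of 2-element vertex subsets (edges regarded as elements of $\mathcal{V}_2$). The 2-Steiner distance matrix $\mathfrak{D}_2(T)$ is indexed by $\mathcal{V}_2$, with entry in row $\{i,j\}$, column $\{k,l\}$ equal to the minimum number of edges of a connected subtree of $T$ whose vertex set contains $i,j,k,l$. $M[B,B]$ denotes the principal submatrix with rows and columns indexed by $B$. *)

(* Defs.v *)
From HB Require Import structures.
From mathcomp Require Import all_boot all_order all_algebra.
Set Implicit Arguments. Unset Strict Implicit. Unset Printing Implicit Defensive.
Import Order.TTheory GRing.Theory Num.Theory.

(* A graph is a relation e on a finType T (assumed symmetric). *)

Definition connected_set (T : finType) (e : rel T) (W : {set T}) : bool :=
  [forall x in W, forall y in W,
     connect [rel a b | [&& e a b, a \in W & b \in W]] x y].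

(* Steiner distance of a vertex set S in a tree: the minimum number of edges of a
   connected subtree whose vertex set contains S.  A connected subtree of a tree with
   vertex set W has exactly #|W| - 1 edges, so this is the minimum of #|W| - 1 over
   connected vertex sets W containing S (the default #|T| is never attained when the
   graph is connected, since W = [set: T] qualifies). *)
Definition steiner (T : finType) (e : rel T) (S : {set T}) : nat :=
  \big[minn/#|T|]_(W : {set T} | (S \subset W) && connected_set e W) (#|W|).-1.

(* Principal submatrix D_2(T)[B,B] of the 2-Steiner distance matrix, rows/columns
   indexed by the elements of B (in the order enum B; the characteristic polynomial
   does not depend on this order).  Entry ({i,j},{k,l}) = steiner {i,j,k,l}. *)
Definition D2sub (T : finType) (e : rel T) (B : {set {set T}}) : 'M[int]_#|B| :=
  \matrix_(i, j) (Posz (steiner e (enum_val i :|: enum_val j))).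

Definition pair (n i j : nat) : {set 'I_n} :=
  [set x : 'I_n | (val x == i) || (val x == j)].

Definition S1edges (n : nat) : {set {set 'I_n}} :=
  [set pair n 0 1; pair n 1 2] :|: [set pair n 2 (val x) | x : 'I_n & 3 <= val x].

Definition S1rel (n : nat) : rel 'I_n :=
  fun x y => (x != y) && (pair n (val x) (val y) \in S1edges n).

Definition B1 (n : nat) : {set {set 'I_n}} :=
  S1edges n :|: [set pair n 0 2; pair n 1 3].

Definition B2 (n : nat) : {set {set 'I_n}} :=
  S1edges n :|: [set pair n 0 2; pair n 3 4].

(* Main.v *)
Require Import Defs.
From HB Require Import structures.
From mathcomp Require Import all_boot all_order all_fingroup all_algebra.
From mathcomp Require Import zify ring.
Import Order.TTheory GRing.Theory Num.Theory.
Set Implicit Arguments. Unset Strict Implicit. Unset Printing Implicit Defensive.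
Local Open Scope ring_scope.

(* All pendant edges at v_2 other than those singled out by the extra pairs play
   the same role, and two of their rows differ only by +1 and -1 at the two
   corresponding columns.  Hence the characteristic polynomial is
   (X + 1)^(n-5) times that of a 6 x 6 quotient matrix, which has the form
   X^6 - (w_5 X^5 + ... + w_0) with all w_j > 0 and linear in n.  So every
   coefficient except the leading one is negative, its absolute value being
   sum_j w_j C(n-5, k-j) - C(n-5, k-6).  The shifted binomial rows all increase
   for k up to (n-4)/2 and all decrease from (n+5)/2 on; the last term is
   absorbed by w_5. *)

(** * Shifted binomial rows: monotonicity and weighted differences *)

(* Coefficient of ['X^k] in [('X + 1) ^+ N * 'X^j]. *)
Definition sbin (N k j : nat) : nat := if (k < j)%N then 0%N else 'C(N, k - j).

Lemma coefX1exp (R : comNzRingType) (N i : nat) :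
  (('X + 1 : {poly R}) ^+ N)`_i = 'C(N, i)%:R.
Proof.
rewrite addrC exprDn coef_sum.
have [leiN|ltNi] := leqP i N.
  rewrite (bigD1 (Ordinal (leiN : (i < N.+1)%N))) //= expr1n mul1r coefMn coefXn eqxx.
  rewrite big1 ?addr0 // => j ne; rewrite expr1n mul1r coefMn coefXn.
  by rewrite (negPf (_ : i != j)) ?mul0rn //; rewrite eq_sym.
rewrite bin_small // big1 // => j _; rewrite expr1n mul1r coefMn coefXn.
by rewrite gtn_eqF ?mul0rn // (leq_ltn_trans _ ltNi) // -ltnS.
Qed.

Lemma coef_char_shape (N k : nat) (w : nat -> nat) :
  (('X + 1) ^+ N * ('X^6 - \sum_(j < 6) (w j)%:R *: 'X^j) : {poly int})`_k =
  Posz (sbin N k 6) - \sum_(j < 6) Posz (w j * sbin N k j).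
Proof.
have E j : (('X + 1) ^+ N * 'X^j : {poly int})`_k = Posz (sbin N k j).
  by rewrite coefMXn /sbin; case: ifP => // _; rewrite coefX1exp natz.
rewrite mulrBr coefB E mulr_sumr coef_sum; congr (_ - _); apply: eq_bigr => j _.
by rewrite -scalerAr coefZ E PoszM natz.
Qed.

(** The identity (i+1) C(N,i+1) = (N-i) C(N,i) reduces the comparison to that of i+1 with N-i; the
    next three lemmas rest on it too. *)
Lemma bin_leS N i : (i.*2.+1 <= N)%N -> ('C(N, i) <= 'C(N, i.+1))%N.
Proof.
move=> h; have := mul_bin_left N i; rewrite -(leq_pmul2l (ltn0Sn i)) => ->.
by rewrite leq_mul2r; apply/orP; right; lia.
Qed.

Lemma bin_ltS N i : (i.*2.+1 < N)%N -> ('C(N, i) < 'C(N, i.+1))%N.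
Proof.
move=> h; have := mul_bin_left N i; rewrite -(ltn_pmul2l (ltn0Sn i)) => ->.
by rewrite ltn_pmul2r ?bin_gt0; lia.
Qed.

Lemma bin_geS N i : (N <= i.*2.+1)%N -> ('C(N, i.+1) <= 'C(N, i))%N.
Proof.
move=> h; have := mul_bin_left N i; rewrite -(leq_pmul2l (ltn0Sn i)) => ->.
by rewrite leq_mul2r; apply/orP; right; lia.
Qed.

Lemma bin_gtS N i : (N < i.*2.+1)%N -> (i <= N)%N -> ('C(N, i.+1) < 'C(N, i))%N.
Proof.
move=> h hi; have := mul_bin_left N i; rewrite -(ltn_pmul2l (ltn0Sn i)) => ->.
by rewrite ltn_pmul2r ?bin_gt0; lia.
Qed.

Lemma sbin_leS N k j : (k.*2.+1 <= N)%N -> (sbin N k j <= sbin N k.+1 j)%N.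
Proof.
move=> h; rewrite /sbin; case: (ltnP k j) => hkj //.
by rewrite ltnNge (leqW hkj) /= subSn //; apply: bin_leS; lia.
Qed.

(** The shift by 1 leaves room for strictness, whereas the unshifted row is flat between k and k+1
    when 2k+1 = N. *)
Lemma sbin_ltS N k : (k.*2.+1 <= N)%N -> (sbin N k 1 < sbin N k.+1 1)%N.
Proof.
move=> h; rewrite /sbin; case: k h => [|k] h; first by rewrite /= bin0.
by rewrite /= !subn1 /=; apply: bin_ltS; lia.
Qed.

Lemma sbin_geS N k j : (j <= k)%N -> (N + j.*2 <= k.*2.+1)%N ->
  (sbin N k.+1 j <= sbin N k j)%N.
Proof.
move=> hkj h; rewrite /sbin !ltnNge hkj (leqW hkj) /= subSn //.
by apply: bin_geS; lia.
Qed.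

Lemma sbin_gtS N k j : (j <= k)%N -> (N + j.*2 < k.*2.+1)%N -> (k <= N + j)%N ->
  (sbin N k.+1 j < sbin N k j)%N.
Proof.
move=> hkj h h2; rewrite /sbin !ltnNge hkj (leqW hkj) /= subSn //.
by rewrite -ltnNge; apply: bin_gtS; lia.
Qed.

(* The leading coefficient has the opposite sign; this bounds what it can cost
   against the coefficient of degree 5. *)
Lemma bin_diff_down N i : (i.+1 < N)%N -> (N <= i.+1.*2.+1)%N ->
  ('C(N, i) + N * 'C(N, i.+2) <= 'C(N, i.+1) + N * 'C(N, i.+1))%N.
Proof.
move=> h1 h2; have e1 := mul_bin_left N i; have e2 := mul_bin_left N i.+1.
have l2 := bin_geS h2.
(* In the left half C(N,i) is at most C(N,i+1) as well, and the two comparisons add up. *)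
have [le|gt] := leqP (i.*2.+1) N.
  by have l1 := bin_leS le; apply: leq_add => //; rewrite leq_mul2l l2 orbT.
move: e1 e2 l2; set a := 'C(N, i); set c := 'C(N, i.+1); set b := 'C(N, i.+2).
move=> e1 e2 _.
(* Both differences become rational multiples of c. After multiplication by (N-i)(i+2) it remains to
   compare (i+2)(2i+1-N) with (N-i)N(2i+3-N), which goes factor by factor since i+2 <= N. *)
have e1' : (N - i)%:Z * (a%:Z - c%:Z) = (i.+1%:Z - (N - i)%:Z) * c%:Z.
  by rewrite mulrBl -PoszM e1 mulrBr -!PoszM; lia.
have e2' : i.+2%:Z * (c%:Z - b%:Z) = (i.+2%:Z - (N - i.+1)%:Z) * c%:Z.
  by rewrite mulrBr -[_ * b%:Z]PoszM e2 mulrBl -!PoszM.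
suff : a%:Z - c%:Z <= N%:Z * (c%:Z - b%:Z) by lia.
have P : 0 < (N - i)%:Z * i.+2%:Z by apply: mulr_gt0; lia.
rewrite -(ler_pM2l P) mulrAC e1'.
have -> : (N - i)%:Z * i.+2%:Z * (N%:Z * (c%:Z - b%:Z)) =
   (N - i)%:Z * N%:Z * (i.+2%:Z * (c%:Z - b%:Z)) by ring.
rewrite e2' !mulrA mulrAC; apply: ler_wpM2r => //.
rewrite [leLHS]mulrC; apply: ler_pM; nia.
Qed.

(** On the rising side the growth of the leading row is paid for by two copies of the row of shift
    5. With differences written as multiples of C(N,i+1), the factor 2 suffices because N-2i-1 <=
    2(N-2i-3) is the hypothesis. *)
Lemma bin_diff_up N i : (i.*2 + 5 <= N)%N ->
  ('C(N, i.+1) + 2 * 'C(N, i.+1) <= 'C(N, i) + 2 * 'C(N, i.+2))%N.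
Proof.
move=> h; have e1 := mul_bin_left N i; have e2 := mul_bin_left N i.+1.
move: e1 e2; set a := 'C(N, i); set c := 'C(N, i.+1); set b := 'C(N, i.+2).
move=> e1 e2.
have e1' : (N - i)%:Z * (c%:Z - a%:Z) = ((N - i)%:Z - i.+1%:Z) * c%:Z.
  by rewrite mulrBr -[_ * a%:Z]PoszM -e1 mulrBl -!PoszM; lia.
have e2' : i.+2%:Z * (b%:Z - c%:Z) = ((N - i.+1)%:Z - i.+2%:Z) * c%:Z.
  by rewrite mulrBr -[_ * b%:Z]PoszM e2 mulrBl -!PoszM.
suff : c%:Z - a%:Z <= 2%:Z * (b%:Z - c%:Z) by lia.
have P : 0 < (N - i)%:Z * i.+2%:Z by apply: mulr_gt0; lia.
rewrite -(ler_pM2l P) mulrAC e1'.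
have -> : (N - i)%:Z * i.+2%:Z * (2%:Z * (b%:Z - c%:Z)) =
   (N - i)%:Z * 2%:Z * (i.+2%:Z * (b%:Z - c%:Z)) by ring.
rewrite e2' !mulrA mulrAC; apply: ler_wpM2r => //.
rewrite mulrC -mulrA; apply: ler_pM; nia.
Qed.

Lemma sbin_diff_down N k : (N + 11 <= k.+1.*2)%N -> (k < N + 5)%N ->
  (sbin N k 6 + N * sbin N k.+1 5 <= sbin N k.+1 6 + N * sbin N k 5)%N.
Proof.
move=> h1 h2; rewrite /sbin.
have [] : (k = 5 \/ 6 <= k)%N by lia.
  (* At k = 5 the row of shift 6 has not started, so [bin_diff_down] does not apply; the hypothesis
     leaves only N = 0 and N = 1. *)
  by move=> kE; rewrite kE; have [->|->] : (N = 0 \/ N = 1)%N by lia.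
move=> hk.
have -> : (k < 6)%N = false by lia.
have -> : (k < 5)%N = false by lia.
have -> : (k.+1 < 6)%N = false by lia.
have -> : (k.+1 < 5)%N = false by lia.
have -> : (k - 5 = (k - 6).+1)%N by lia.
have -> : (k.+1 - 5 = (k - 6).+2)%N by lia.
have -> : (k.+1 - 6 = (k - 6).+1)%N by lia.
by apply: bin_diff_down; lia.
Qed.

Lemma sbin_diff_up N k : (k.*2.+1 <= N)%N ->
  (sbin N k.+1 6 + 2 * sbin N k 5 <= sbin N k 6 + 2 * sbin N k.+1 5)%N.
Proof.
move=> h1; rewrite /sbin.
have [] : (k < 5 \/ (k = 5 \/ 6 <= k))%N by lia.
  by move=> hk; rewrite ltnS hk (leqW hk).
case.
  by move=> kE; rewrite kE /= !bin0 bin1; lia.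
move=> hk.
have -> : (k < 6)%N = false by lia.
have -> : (k < 5)%N = false by lia.
have -> : (k.+1 < 6)%N = false by lia.
have -> : (k.+1 < 5)%N = false by lia.
have -> : (k - 5 = (k - 6).+1)%N by lia.
have -> : (k.+1 - 5 = (k - 6).+2)%N by lia.
have -> : (k.+1 - 6 = (k - 6).+1)%N by lia.
by apply: bin_diff_up; lia.
Qed.

(** With i = k-6, (N-i) C(N,i) = (i+1) C(N,i+1), where N-i >= 1 and i+1 <= N. This keeps the
    coefficients below the leading one from becoming positive. *)
Lemma sbin_ratio N k : (k <= N + 5)%N -> (sbin N k 6 <= N * sbin N k 5)%N.
Proof.
move=> h; rewrite /sbin; case: (ltnP k 6) => // hk.
rewrite ifN -?leqNgt; last lia.
have -> : (k - 5 = (k - 6).+1)%N by lia.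
have := mul_bin_left N (k - 6); set a := 'C(N, k - 6); set b := 'C(N, _) => e.
have : (a <= (N - (k - 6)) * a)%N by apply: leq_pmull; lia.
rewrite -e => /leq_trans; apply; rewrite leq_mul2r; lia.
Qed.

(** * Location of the largest coefficient *)

(** Every maximiser is bounded, not just one; [(n + 5)./2] is the ceiling of (n+4)/2. *)
Definition mode_bounded (n : nat) (p : {poly int}) : Prop :=
  forall t : nat, (t <= n.+1)%N ->
    (forall k : nat, (k <= n.+1)%N -> `|p`_k| <= `|p`_t|) ->
    ((n - 4)./2 <= t <= (n + 5)./2)%N.

(** Here N = n-5. Outside the window a neighbouring coefficient is strictly larger in absolute
    value: [w 1] gives strictness on the left, [w 4] on the right, and [w 5] outweighs the leading
    term. *)
Lemma mode_boundedP (N : nat) (w : nat -> nat) :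
  (0 < w 1)%N -> (0 < w 4)%N -> (N + 2 <= w 5)%N ->
  mode_bounded N.+4.+1
    (('X + 1) ^+ N * ('X^6 - \sum_(j < 6) (w j)%:R *: 'X^j)).
Proof.
move=> w1 w4 w5 t ht hmax.
pose f k := (\sum_(j < 6) w j * sbin N k j)%N.
have fE k : f k = (w 0 * sbin N k 0 + w 1 * sbin N k 1 + w 2 * sbin N k 2 +
   w 3 * sbin N k 3 + w 4 * sbin N k 4 + w 5 * sbin N k 5)%N.
  by rewrite /f !big_ord_recr big_ord0.
have aE k : (('X + 1) ^+ N * ('X^6 - \sum_(j < 6) (w j)%:R *: 'X^j) : {poly int})`_k
    = Posz (sbin N k 6) - Posz (f k).
  rewrite coef_char_shape /f; congr (_ - _).
  by rewrite -(big_morph Posz PoszD (erefl _)).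
have neg k : (k <= N + 5)%N -> (sbin N k 6 <= f k)%N.
  move=> /sbin_ratio h; rewrite (leq_trans h) // fE.
  apply: (@leq_trans (w 5 * sbin N k 5)); last exact: leq_addl.
  by rewrite leq_mul2r (leq_trans (leq_addr 2 N) w5) orbT.
have wle k k' j : (sbin N k j <= sbin N k' j)%N ->
    (w j * sbin N k j <= w j * sbin N k' j)%N.
  by move=> h; rewrite leq_mul2l h orbT.
apply/andP; split; rewrite leqNgt; apply/negP => hlt.
  have h : (t.*2.+1 <= N)%N by lia.
  have := hmax t.+1; rewrite !aE => /(_ ltac:(lia)).
  have n1 := neg t ltac:(lia); have n2 := neg t.+1 ltac:(lia).
  have d := sbin_diff_up h.
  have l0 := wle _ _ _ (sbin_leS 0 h); have l2 := wle _ _ _ (sbin_leS 2 h).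
  have l3 := wle _ _ _ (sbin_leS 3 h); have l4 := wle _ _ _ (sbin_leS 4 h).
  (* Row 0 may be flat here (2t+1 = N), so the strict increase is taken from row 1. *)
  have l1 : (w 1 * sbin N t 1 < w 1 * sbin N t.+1 1)%N.
    by rewrite ltn_pmul2l // sbin_ltS.
  have l5 : ((w 5 - 2) * sbin N t 5 <= (w 5 - 2) * sbin N t.+1 5)%N.
    by rewrite leq_mul2l sbin_leS ?orbT.
  have e5 x : (w 5 * x = (w 5 - 2) * x + 2 * x)%N by rewrite -mulnDl subnK //; lia.
  move: n1 n2; rewrite !fE !e5; lia.
(* At the top degree the coefficient is 1, but in degree N+5 the absolute value is at least [w 5] -
   N >= 2. *)
have [tE|tle] : (t = N + 6 \/ t <= N + 5)%N by lia.
  have := hmax (N + 5)%N; rewrite !aE => /(_ ltac:(lia)).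
  have n1 := neg (N + 5)%N ltac:(lia).
  have s6 : (sbin N (N + 5) 6 <= N)%N.
    rewrite /sbin; case: ltnP => // h; rewrite (_ : N + 5 - 6 = N.-1)%N; last lia.
    by rewrite -bin_sub ?leq_pred // (_ : N - N.-1 = 1)%N ?bin1 //; lia.
  have s5 : (sbin N (N + 5) 5 = 1)%N.
    by rewrite /sbin ifN ?addnK ?binn // -leqNgt leq_addl.
  have z j : (j < 6)%N -> sbin N t j = 0%N.
    by move=> hj; rewrite /sbin; case: ifP => // _; rewrite bin_small //; lia.
  have s6' : sbin N t 6 = 1%N.
    by rewrite /sbin tE ifN ?addnK ?binn // -leqNgt leq_addl.
  by move: n1; rewrite !fE s6' !z // s5; lia.
case: t ht hmax hlt tle => [|t] ht hmax hlt tle; first by [].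
have h : (N + 11 <= t.+1.*2)%N by lia.
have := hmax t; rewrite !aE => /(_ ltac:(lia)).
have n1 := neg t ltac:(lia); have n2 := neg t.+1 ltac:(lia).
have d := sbin_diff_down h ltac:(lia).
have le j : (j <= 5)%N -> (sbin N t.+1 j <= sbin N t j)%N.
  by move=> hj; apply: sbin_geS; lia.
have l0 := wle _ _ _ (le 0%N isT); have l1 := wle _ _ _ (le 1%N isT).
have l2 := wle _ _ _ (le 2%N isT); have l3 := wle _ _ _ (le 3%N isT).
(* Row 5 may be flat at the boundary N+11 = 2(t+1), so strictness comes from row 4. *)
have l4 : (w 4 * sbin N t.+1 4 < w 4 * sbin N t 4)%N.
  by rewrite ltn_pmul2l // sbin_gtS //; lia.
have l5 : ((w 5 - N) * sbin N t.+1 5 <= (w 5 - N) * sbin N t 5)%N.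
  by rewrite leq_mul2l le ?orbT.
have e5 x : (w 5 * x = (w 5 - N) * x + N * x)%N by rewrite -mulnDl subnK //; lia.
move: n1 n2; rewrite !fE !e5; lia.
Qed.

(** * Characteristic polynomials under conjugation, reindexing and merging of twin rows *)

Lemma char_poly_conj (R : comNzRingType) n (P Q M : 'M[R]_n) :
  P *m Q = 1%:M -> char_poly (P *m M *m Q) = char_poly M.
Proof.
move=> PQ; rewrite /char_poly /char_poly_mx.
pose Pp := map_mx (@polyC R) P; pose Qp := map_mx (@polyC R) Q.
have PQp : Pp *m Qp = 1%:M by rewrite -map_mxM PQ map_mx1.
have -> : 'X%:M - map_mx polyC (P *m M *m Q) =
    Pp *m ('X%:M - map_mx (@polyC R) M) *m Qp.
  rewrite mulmxBr mulmxBl !map_mxM; congr (_ - _).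
  by rewrite scalar_mxC -mulmxA PQp mulmx1.
by rewrite !det_mulmx mulrAC -det_mulmx PQp det1 mul1r.
Qed.

(** The two sizes are kept apart because [#|B|] equals the length of an explicit list only
    propositionally. *)
Lemma char_poly_mxsub (R : comNzRingType) m n (h : 'I_m -> 'I_n) (A : 'M[R]_n) :
  bijective h -> char_poly (mxsub h h A) = char_poly A.
Proof.
move=> bij_h.
have mn : m = n by have := bij_eq_card bij_h; rewrite !card_ord.
case: n / mn h A bij_h => h A bij_h.
pose s := perm (bij_inj bij_h).
have -> : mxsub h h A = perm_mx s *m A *m perm_mx s^-1.
  rewrite -row_permE -col_permE; apply/matrixP => i j.
  by rewrite !mxE !permE.
by apply: char_poly_conj; rewrite -perm_mxM mulgV perm_mx1.
Qed.

Lemma char_poly_ublock (R : comNzRingType) p q (A : 'M[R]_p) (B : 'M[R]_(p, q))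
    (D : 'M[R]_q) :
  char_poly (block_mx A B 0 D) = char_poly A * char_poly D.
Proof.
rewrite /char_poly /char_poly_mx map_block_mx scalar_mx_block opp_block_mx.
by rewrite add_block_mx map_mx0 subr0 sub0r det_ublock.
Qed.

Lemma char_poly_oppr1 (R : comNzRingType) n :
  char_poly (- 1%:M : 'M[R]_n) = ('X + 1) ^+ n.
Proof.
rewrite /char_poly /char_poly_mx raddfN /= map_mx1 opprK.
by rewrite -raddfD /= det_scalar.
Qed.

(** Entries are functions of natural numbers, so that indices such as p + k need no casts between
    ordinals. *)
Definition nat_mx (R : Type) (n : nat) (F : nat -> nat -> R) : 'M[R]_n :=
  \matrix_(i < n, j < n) F i j.

(* If each of the last [N] rows differs from row [r] only by the entries [+1] in
   column [r] and [-1] on the diagonal, subtracting row [r] from them and adding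
   their columns to column [r] makes the matrix block triangular. *)
Lemma char_poly_twins (R : comNzRingType) (p N r : nat) (F : nat -> nat -> R) :
  (r < p)%N ->
  (forall k j, (k < N)%N -> (j < p + N)%N ->
     F (p + k)%N j = F r j + (j == r)%:R - (j == p + k)%N%:R) ->
  char_poly (nat_mx (p + N) F) =
  char_poly (nat_mx p (fun i j => F i j + (j == r)%:R * \sum_(k < N) F i (p + k)%N))
  * ('X + 1) ^+ N.
Proof.
move=> ltrp twin.
pose S : 'M[R]_p := nat_mx p F.
pose U : 'M[R]_(p, N) := \matrix_(i, j) F i (p + j)%N.
pose V : 'M[R]_(N, p) := \matrix_(i, j) F (p + i)%N j.
pose W : 'M[R]_N := \matrix_(i, j) F (p + i)%N (p + j)%N.
pose C : 'M[R]_(N, p) := \matrix_(i, j) (- (j == r :> nat)%:R).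
have ME : nat_mx (p + N) F = block_mx S U V W.
  apply/matrixP => i j; rewrite -(splitK i) -(splitK j).
  by case: (split i) => i'; case: (split j) => j';
    rewrite ?block_mxEul ?block_mxEur ?block_mxEdl ?block_mxEdr !mxE.
have rowC q (B : 'M[R]_(p, q)) : C *m B = \matrix_(i, j) (- B (Ordinal ltrp) j).
  apply/matrixP => i j; rewrite !mxE (bigD1 (Ordinal ltrp)) //= !mxE eqxx mulN1r.
  rewrite big1 ?addr0 // => k ne; rewrite mxE.
  by rewrite (negPf (_ : k != r :> nat)) ?oppr0 ?mul0r.
rewrite -(@char_poly_conj _ _ (block_mx 1%:M 0 C 1%:M) (block_mx 1%:M 0 (- C) 1%:M));
  last first.
  rewrite mulmx_block !mulmx0 !mul0mx !mulmx1 !mul1mx !addr0 add0r subrr.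
  by rewrite -scalar_mx_block.
have W1 : C *m U + W = - 1%:M.
  apply/matrixP => i j; rewrite rowC !mxE twin ?ltn_add2l //.
  rewrite eqn_add2l gtn_eqF ?ltn_addr // addr0 addrA addNr sub0r.
  by rewrite -val_eqE eq_sym.
(* The column operation adds (-I)(-C) = C to this block, which therefore vanishes. *)
have V1 : C *m S + V = - C.
  apply/matrixP => i j; rewrite rowC !mxE twin ?ltn_addr // opprK.
  by rewrite (@ltn_eqF j (p + i)%N) ?ltn_addr // subr0 addKr.
rewrite ME !mulmx_block !mul1mx !mul0mx !addr0 !mulmx1 !mulmx0 !add0r W1 V1.
rewrite mulNmx mul1mx opprK addNr char_poly_ublock char_poly_oppr1.
congr (char_poly _ * _); apply/matrixP => i j; rewrite !mxE; congr (_ + _).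
by rewrite mulr_sumr; apply: eq_bigr => k _; rewrite !mxE opprK mulrC.
Qed.

(** * Steiner distance through a least connected superset *)

(** A least connected superset of S attains the minimum; the default [#|T|] is harmless, being no
    smaller than [#|H|.-1]. *)
Lemma steinerE (T : finType) (e : rel T) (S H : {set T}) :
  S \subset H -> connected_set e H ->
  (forall W : {set T}, S \subset W -> connected_set e W -> H \subset W) ->
  steiner e S = #|H|.-1.
Proof.
move=> SH cH minH; apply/eqP; rewrite eqn_leq; apply/andP; split; last first.
  apply: (big_ind (fun x => #|H|.-1 <= x)%N) => [|x y hx hy|W /andP[SW cW]].
  - by rewrite (leq_trans (leq_pred _)) ?max_card.
  - by rewrite leq_min hx.
  - have := subset_leq_card (minH W SW cW); lia.
rewrite /steiner -big_filter; set r := filter _ _.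
have : H \in r by rewrite mem_filter SH cH mem_index_enum.
elim: r => // W r IH; rewrite inE big_cons geq_min => /predU1P[->|/IH ->].
  by rewrite leqnn.
by rewrite orbT.
Qed.

(** Used to force cut vertices into W: were one missing, the indicator of a side would be constant
    along the edges left in W. *)
Lemma connected_set_cut (T : finType) (e : rel T) (W : {set T}) (P : pred T) (x y : T) :
  connected_set e W -> x \in W -> y \in W ->
  (forall a b, e a b -> a \in W -> b \in W -> P a = P b) -> P x = P y.
Proof.
move=> /forall_inP/(_ x) cW xW yW closP.
have /forall_inP/(_ y yW) cxy := cW xW.
by apply: (@closed_connect _ _ P _ x y cxy) => a b /and3P[eab aW bW]; exact: closP.
Qed.

Lemma connected_set_root (T : finType) (e : rel T) (W : {set T}) (r : T) :
  symmetric e ->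
  (forall x, x \in W -> connect [rel a b | [&& e a b, a \in W & b \in W]] x r) ->
  connected_set e W.
Proof.
move=> syme toroot; apply/forall_inP => x xW; apply/forall_inP => y yW.
apply: connect_trans (toroot x xW) _.
rewrite sym_connect_sym ?toroot // => a b /=.
by rewrite syme; congr (_ && _); rewrite andbC.
Qed.

(** * Steiner distances in the tree *)

Lemma in_pair n i j (x : 'I_n) : (x \in pair n i j) = ((x : nat) \in [:: i; j]).
Proof. by rewrite !inE. Qed.

Lemma pair_inj n a b c d : (a < b)%N -> (b < n)%N -> (c < d)%N -> (d < n)%N ->
  pair n a b = pair n c d -> (a, b) = (c, d).
Proof.
move=> ab bn cd dn /setP eqp.
have ha := eqp (Ordinal (ltn_trans ab bn)).
have hb := eqp (Ordinal bn).
have hc := eqp (Ordinal (ltn_trans cd dn)).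
have hd := eqp (Ordinal dn).
move: ha hb hc hd; rewrite !in_pair /= !inE !eqxx ?orbT /=.
move=> ha hb hc hd; congr (_, _); lia.
Qed.

Lemma pairC n a b : pair n a b = pair n b a.
Proof. by apply/setP => x; rewrite !inE orbC. Qed.

Definition adj (a b : nat) : bool :=
  [|| (a == 0) && (b == 1), (a == 1) && (b == 2) | (a == 2) && (2 < b)]%N.

Lemma S1relE n (x y : 'I_n) : (3 <= n)%N -> S1rel x y = adj x y || adj y x.
Proof.
move=> n3; rewrite /S1rel /adj -val_eqE /=.
wlog xy : x y / (x <= y)%N => [W|].
  case: (leqP x y) => [|/ltnW] h; first exact: W.
  by rewrite eq_sym pairC W // orbC.
apply/idP/idP.
  case/andP=> ne; have {}xy : (x < y)%N by rewrite ltn_neqAle ne.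
  rewrite !inE => /orP[/orP[]/eqP|/imsetP[z]].
  - by move/pair_inj => /(_ xy (ltn_ord y) isT ltac:(lia)) [-> ->].
  - by move/pair_inj => /(_ xy (ltn_ord y) isT ltac:(lia)) [-> ->].
  - rewrite inE /= => z3 /pair_inj => /(_ xy (ltn_ord y) z3 (ltn_ord z)) [-> ->].
    by rewrite eqxx z3 !orbT.
move=> h; apply/andP; split; first lia.
have [[-> ->]|[[-> ->]|[x2 y3]]] : (x = 0 :> nat /\ y = 1 :> nat \/
   (x = 1 :> nat /\ y = 2 :> nat \/ x = 2 :> nat /\ 2 < y))%N by lia.
- by rewrite !inE eqxx.
- by rewrite !inE eqxx orbT.
- rewrite !inE; apply/orP; right; apply/imsetP; exists y => //; last by rewrite x2.
  by rewrite inE.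
Qed.

(* Only the cut vertices 1 and 2 can be forced into a connected set containing [s]. *)
Definition hull (s : seq nat) : seq nat :=
  s ++ nseq ((0 \in s) && has (fun y => y != 0) s)%N 1%N
    ++ nseq (has (fun x => has (fun y => [&& 2 < x, y != x & y != 2])%N s) s) 2%N.

Definition seq_set n (s : seq nat) : {set 'I_n} := [set x : 'I_n | (x : nat) \in s].

Lemma card_seq_set n s : all (fun x => x < n)%N s -> #|seq_set n s| = size (undup s).
Proof.
move=> sn; rewrite cardE -(size_map val); apply: perm_size; apply: uniq_perm.
- by rewrite map_inj_uniq ?enum_uniq //; exact: val_inj.
- exact: undup_uniq.
move=> k; rewrite mem_undup; apply/mapP/idP => [[x]|ks].
  by rewrite mem_enum inE => xs ->.
by exists (Ordinal (allP sn _ ks)) => //; rewrite mem_enum inE.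
Qed.

Lemma mem_nseq_bool (b : bool) (x y : nat) : (x \in nseq b y) = b && (x == y).
Proof. by case: b; rewrite ?inE. Qed.

(** The hull is connected because each of its vertices reaches a root, 1 or 2, which two distinct
    elements of s guarantee. It is least because removing 1 isolates 0 and removing 2 isolates every
    leaf beyond it. *)
Lemma steiner_S1 n (s : seq nat) : (3 <= n)%N -> all (fun x => x < n)%N s ->
  has (fun x => has (fun y => x != y) s) s ->
  steiner (@S1rel n) (seq_set n s) = (size (undup (hull s))).-1.
Proof.
move=> n3 sn two.
have hn : all (fun x => x < n)%N (hull s).
  rewrite /hull !all_cat sn /=; apply/andP; split; apply/allP => x;
    by rewrite mem_nseq_bool => /andP[_ /eqP->]; lia.
rewrite -(card_seq_set hn); apply: steinerE.
- by apply/subsetP => x; rewrite !inE mem_cat => ->.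
- set H := seq_set n (hull s).
  have step (x y : 'I_n) : x \in H -> y \in H -> adj x y || adj y x ->
      connect [rel a b | [&& S1rel a b, a \in H & b \in H]] x y.
    by move=> xH yH xy; apply: connect1; rewrite /= S1relE // xy xH.
  have other x : exists2 y, y \in s & y != x.
    move: two => /hasP[a as_ /hasP[b bs ab]].
    by have [<-|] := eqVneq b x; [exists a | exists b].
  have h0 : (0 \in hull s -> 1 \in hull s)%N.
    rewrite /hull !mem_cat !mem_nseq_bool !andbF !orbF => s0.
    have [y ys y0] := other 0%N.
    by rewrite s0 /= (_ : has _ s) ?orbT //; apply/hasP; exists y.
  have hleaf x : (x \in hull s -> 2 < x -> 2 \in hull s)%N.
    rewrite /hull !mem_cat !mem_nseq_bool => + x2.
    rewrite [x == 1%N]gtn_eqF ?[x == 2%N]gtn_eqF ?(ltnW x2) // !andbF !orbF => xs.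
    have [y ys yx] := other x.
    have [y2|y2] := eqVneq y 2%N; first by rewrite -y2 ys.
    rewrite (_ : has _ s && _) ?orbT //; apply/andP; split => //.
    by apply/hasP; exists x => //; apply/hasP; exists y => //; rewrite x2 yx.
  (* If 2 is absent, so is every leaf beyond it, and a nonzero element of s can only be 1. *)
  pose root : nat := if (2 \in hull s)%N then 2%N else 1%N.
  have rootH : root \in hull s.
    rewrite /root; case: ifP => // /negbT n2.
    have [y ys y0] := other 0%N.
    have yh : y \in hull s by rewrite mem_cat ys.
    have yne : y != 2%N by apply: contraNneq n2 => <-.
    have yle : (y <= 2)%N by rewrite leqNgt; apply: contra n2 => /(hleaf _ yh).
    by rewrite (_ : 1%N = y) //; lia.
  have rn : (root < n)%N by exact: (allP hn).
  apply: (@connected_set_root _ _ _ (Ordinal rn)) => [a b|x].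
    by rewrite !S1relE // orbC.
  rewrite inE => xh; have xH : x \in H by rewrite inE.
  have rH : Ordinal rn \in H by rewrite inE.
  have [xr|xr] := eqVneq x (Ordinal rn); first by rewrite xr connect0.
  move: xr rH step; rewrite -val_eqE /=; rewrite /root in rootH rn *.
  case: (boolP (2 \in hull s)%N) => h2 in rootH rn * => xr rH step.
    (* Only 0 is not adjacent to 2; it goes through 1. *)
    have [x0|x0] := eqVneq (x : nat) 0%N; last first.
      by apply: step => //; rewrite /adj /=; lia.
    have h1 : (1 \in hull s)%N by apply: h0; rewrite -x0.
    have n1 : (1 < n)%N by exact: (allP hn).
    apply: (@connect_trans _ _ (Ordinal n1)); apply: step => //; rewrite ?inE //.
    by rewrite /adj x0.
  apply: step => //.
  have xne : x != 2%N :> nat by apply: contraNneq h2 => <-.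
  have xle : (x <= 2)%N by rewrite leqNgt; apply: contra h2 => /(hleaf _ xh).
  by rewrite /adj /=; lia.
move=> W sW cW; apply/subsetP => z; rewrite inE /hull !mem_cat !mem_nseq_bool.
have inW (x : 'I_n) : (x : nat) \in s -> x \in W.
  by move=> xs; apply: (subsetP sW); rewrite inE.
have ordW k (ks : k \in s) : Ordinal (allP sn _ ks) \in W by exact: inW.
case/or3P => [/inW //|/andP[/andP[s0 /hasP[y ys y0]] /eqP z1]|/andP[]].
  apply: contraT => zW.
  (* The only neighbour of 0 is 1, missing from W, so being 0 is constant along the edges in W. *)
  suff E : (0 == 0)%N = (y == 0)%N by rewrite -E in y0.
  apply: (connected_set_cut (P := fun a : 'I_n => (a : nat) == 0%N) cW
    (ordW _ s0) (ordW _ ys)) => a b; rewrite S1relE // => ab aW bW.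
  have : a != z by apply: contraNneq zW => <-.
  have : b != z by apply: contraNneq zW => <-.
  by move: ab; rewrite -!val_eqE /adj /=; lia.
case/hasP => x xs /hasP[y ys /and3P[x2 yx y2]] /eqP z2.
apply: contraT => zW.
(* Likewise x > 2 has 2 as its only neighbour. *)
suff E : (x == x) = (y == x) by rewrite -E eqxx in yx.
apply: (connected_set_cut (P := fun a : 'I_n => (a : nat) == x) cW
  (ordW _ xs) (ordW _ ys)) => a b; rewrite S1relE // => ab aW bW.
have : a != z by apply: contraNneq zW => <-.
have : b != z by apply: contraNneq zW => <-.
by move: ab; rewrite -!val_eqE /adj /=; lia.
Qed.

(** * Symbolic 6 x 6 determinants *)

Lemma eq_nat_mx (R : Type) n (F G : nat -> nat -> R) :
  (forall i j, (i < n)%N -> (j < n)%N -> F i j = G i j) -> nat_mx n F = nat_mx n G.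
Proof. by move=> FG; apply/matrixP => i j; rewrite !mxE FG. Qed.

(** Unlike [\det], this expansion simplifies to an explicit expression that [ring] can treat. *)
Fixpoint laplace (R : pzRingType) (n : nat) (F : nat -> nat -> R) : R :=
  if n is m.+1 then
    foldr (fun j s => (-1) ^+ j * F 0%N j *
                      laplace m (fun i k => F i.+1 (bump j k)) + s) 0 (iota 0 n)
  else 1.

Lemma det_nat_mx (R : comNzRingType) n (F : nat -> nat -> R) :
  \det (nat_mx n F) = laplace n F.
Proof.
elim: n F => [|n IH] F; first by rewrite det_mx00.
rewrite (expand_det_row _ ord0) [laplace _ _]/=.
transitivity (\sum_(0 <= j < n.+1) (-1) ^+ j * F 0%N j *
    laplace n (fun i k => F i.+1 (bump j k))).
  rewrite big_mkord; apply: eq_bigr => j _; rewrite -IH mxE /cofactor add0n.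
  rewrite mulrCA mulrA; congr (_ * \det _).
  by apply/matrixP => a b; rewrite !mxE.
by rewrite unlock.
Qed.

Definition table (rows : seq (seq nat)) (i j : nat) : nat :=
  nth 0%N (nth [::] rows i) j.

Lemma char_poly_nat_mx (R : comNzRingType) n (F : nat -> nat -> R) :
  char_poly (nat_mx n F) = laplace n (fun i j => 'X *+ (i == j) - (F i j)%:P).
Proof.
rewrite /char_poly -det_nat_mx; congr (\det _).
by apply/matrixP => i j; rewrite !mxE.
Qed.


(* Columns: e_1, e_2, {v_0,v_2}, {v_1,v_3}, e_3, e_4, and any e_i with i >= 5. *)
Definition tabB1 := table
   [:: [:: 1; 2; 2; 3; 3; 3; 3];
       [:: 2; 1; 2; 2; 2; 2; 2];
       [:: 2; 2; 2; 3; 3; 3; 3];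
       [:: 3; 2; 3; 2; 2; 3; 3];
       [:: 3; 2; 3; 2; 1; 2; 2];
       [:: 3; 2; 3; 3; 2; 1; 2]]%N.

(* Columns: e_1, e_2, {v_0,v_2}, {v_3,v_4}, e_3, e_5, e_4, and any e_i with i >= 6. *)
Definition tabB2 := table
   [:: [:: 1; 2; 2; 4; 3; 3; 3; 3];
       [:: 2; 1; 2; 3; 2; 2; 2; 2];
       [:: 2; 2; 2; 4; 3; 3; 3; 3];
       [:: 4; 3; 4; 2; 2; 3; 2; 3];
       [:: 3; 2; 3; 2; 1; 2; 2; 2];
       [:: 3; 2; 3; 3; 2; 1; 2; 2];
       [:: 3; 2; 3; 2; 2; 2; 1; 2]]%N.

(** Columns for n = 5: e_1, e_2, {v_0,v_2}, {v_3,v_4}, e_3, e_4. *)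
Definition tabB2_5 := table
   [:: [:: 1; 2; 2; 4; 3; 3];
       [:: 2; 1; 2; 3; 2; 2];
       [:: 2; 2; 2; 4; 3; 3];
       [:: 4; 3; 4; 2; 2; 2];
       [:: 3; 2; 3; 2; 1; 2];
       [:: 3; 2; 3; 2; 2; 1]]%N.

Lemma laplace_B1 (R : comNzRingType) (x N : R) :
  laplace 6 (fun i j => x *+ (i == j) -
    ((tabB1 i j)%:R + (j == 5)%:R * ((tabB1 i 6)%:R * N))) =
  x ^+ 6 - ((4 + N) + (37 + 13 * N) * x + (115 + 45 * N) * x ^+ 2 +
    (144 + 54 * N) * x ^+ 3 + (69 + 21 * N) * x ^+ 4 + (8 + 2 * N) * x ^+ 5).
Proof. by rewrite /laplace /tabB1 /table /=; ring. Qed.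

(** Here N = n-6. The summand at column 4 is the column of e_4 merged into that of e_3, as these two
    leaves are twins as well. *)
Lemma laplace_B2 (R : comNzRingType) (x N : R) :
  laplace 6 (fun i j => x *+ (i == j) -
    ((tabB2 i j)%:R + (j == 5)%:R * ((tabB2 i 7)%:R * N) +
     (j == 4)%:R * (tabB2 i 6)%:R)) =
  x ^+ 6 - ((5 + N) + (56 + 15 * N) * x + (185 + 53 * N) * x ^+ 2 +
    (231 + 62 * N) * x ^+ 3 + (104 + 21 * N) * x ^+ 4 + (10 + 2 * N) * x ^+ 5).
Proof. by rewrite /laplace /tabB2 /table /=; ring. Qed.

(** The coefficients are those of [laplace_B2] at N = -1. *)
Lemma laplace_B2_5 (R : comNzRingType) (x : R) :
  laplace 6 (fun i j => x *+ (i == j) - (tabB2_5 i j)%:R) =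
  x ^+ 6 - (4 + 41 * x + 132 * x ^+ 2 + 169 * x ^+ 3 + 83 * x ^+ 4 + 8 * x ^+ 5).
Proof. by rewrite /laplace /tabB2_5 /table /=; ring. Qed.

(** * Explicit enumerations of the index sets and their distance tables *)

Definition steiner4 (p q : nat * nat) : nat :=
  (size (undup (hull [:: p.1; p.2; q.1; q.2]))).-1.

(** The order is that of the columns of [tabB1]; from index 4 on, index k+1 stands for e_k. *)
Definition B1_pair (i : nat) : nat * nat :=
  match i with
  | 0 => (0, 1) | 1 => (1, 2) | 2 => (0, 2) | 3 => (1, 3) | k.+1 => (2, k)
  end%N.

(* e_5 stands before e_4, so that first e_6, e_7, ... are merged into e_5 and then
   e_4 into e_3; for n = 5 there is no e_5, whence [B2_5_pair]. *)
Definition B2_pair (i : nat) : nat * nat :=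
  match i with
  | 0 => (0, 1) | 1 => (1, 2) | 2 => (0, 2) | 3 => (3, 4)
  | 4 => (2, 3) | 5 => (2, 5) | 6 => (2, 4) | k.+1 => (2, k)
  end%N.

Definition B2_5_pair (i : nat) : nat * nat :=
  match i with
  | 0 => (0, 1) | 1 => (1, 2) | 2 => (0, 2) | 3 => (3, 4) | k.+1 => (2, k)
  end%N.

(** An explicit enumeration f differs from [enum B] by the bijection h, under which the
    characteristic polynomial is invariant. *)
Lemma char_poly_D2sub (T : finType) (e : rel T) (B : {set {set T}}) m
    (f : 'I_m -> {set T}) :
  injective f -> B = [set f i | i : 'I_m] ->
  char_poly (D2sub e B) =
  char_poly (\matrix_(i < m, j < m) Posz (steiner e (f i :|: f j))).
Proof.
move=> f_inj BE.
have fB i : f i \in B by rewrite BE imset_f.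
pose h i := enum_rank_in (fB i) (f i).
have hK i : enum_val (h i) = f i by rewrite enum_rankK_in.
have h_inj : injective h by move=> i j hij; apply: f_inj; rewrite -!hK hij.
have h_bij : bijective h.
  by apply: inj_card_bij => //; rewrite !card_ord BE card_imset ?card_ord.
rewrite -(char_poly_mxsub _ h_bij); congr char_poly.
by apply/matrixP => i j; rewrite !mxE !hK.
Qed.

Lemma char_poly_S1 n m (B : {set {set 'I_n}}) (g : nat -> nat * nat) :
  (3 <= n)%N ->
  (forall i, (i < m)%N -> (g i).1 < (g i).2 < n)%N ->
  (forall i j, (i < m)%N -> (j < m)%N -> g i = g j -> i = j) ->
  B = [set pair n (g (val i)).1 (g (val i)).2 | i : 'I_m] ->
  char_poly (D2sub (@S1rel n) B) =
  char_poly (nat_mx m (fun i j => Posz (steiner4 (g i) (g j)))).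
Proof.
move=> n3 g_lt g_inj BE; rewrite (char_poly_D2sub _ _ BE) => [|i j].
  congr char_poly; apply/matrixP => i j; rewrite !mxE; congr Posz.
  have /andP[i1 i2] := g_lt i (ltn_ord i); have /andP[j1 j2] := g_lt j (ltn_ord j).
  rewrite /steiner4 -(@steiner_S1 n [:: (g i).1; (g i).2; (g j).1; (g j).2]) //.
  - by congr (steiner _ _); apply/setP => x; rewrite !inE !orbA.
  - by rewrite /= i2 j2 (ltn_trans i1 i2) (ltn_trans j1 j2).
  - by rewrite /= (ltn_eqF i1) !orbT.
have /andP[i1 i2] := g_lt i (ltn_ord i); have /andP[j1 j2] := g_lt j (ltn_ord j).
move/pair_inj => /(_ i1 i2 j1 j2) gij; apply/val_inj/g_inj; rewrite ?ltn_ord //.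
by rewrite (surjective_pairing (g i)) gij -surjective_pairing.
Qed.

Lemma B1E n : (5 <= n)%N ->
  B1 n = [set pair n (B1_pair (val i)).1 (B1_pair (val i)).2 | i : 'I_n.+1].
Proof.
move=> n5; apply/setP => A; apply/idP/imsetP => [|[[i lti] _ ->]].
  rewrite !inE -!orbA => /or4P[/eqP->|/eqP->|/imsetP[x x3 ->]|/orP[]/eqP->].
  - by exists (inord 0) => //; rewrite /= inordK.
  - by exists (inord 1) => //; rewrite /= inordK //; lia.
  - rewrite inE /= in x3; have xn := ltn_ord x; exists (inord x.+1) => //.
    by rewrite /= inordK //; case: (nat_of_ord x) x3 => [|[|[|k]]].
  - by exists (inord 2) => //; rewrite /= inordK //; lia.
  - by exists (inord 3) => //; rewrite /= inordK //; lia.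
case: i lti => [|[|[|[|i]]]] lti; rewrite !inE ?eqxx ?orbT //=.
apply/orP; left; apply/orP; right.
have lt' : (i.+3 < n)%N by rewrite -ltnS.
by apply/imsetP; exists (Ordinal lt'); rewrite // inE.
Qed.

Lemma B2E n : (6 <= n)%N ->
  B2 n = [set pair n (B2_pair (val i)).1 (B2_pair (val i)).2 | i : 'I_n.+1].
Proof.
move=> n6; apply/setP => A; apply/idP/imsetP => [|[[i lti] _ ->]].
  rewrite !inE -!orbA => /or4P[/eqP->|/eqP->|/imsetP[x x3 ->]|/orP[]/eqP->].
  - by exists (inord 0) => //; rewrite /= inordK.
  - by exists (inord 1) => //; rewrite /= inordK //; lia.
  - rewrite inE /= in x3; have xn := ltn_ord x; rewrite /=.
    have [->|x4] := eqVneq (nat_of_ord x) 3%N;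
      first by exists (inord 4); rewrite /= ?inordK //; lia.
    have [->|x5] := eqVneq (nat_of_ord x) 4%N;
      first by exists (inord 6); rewrite /= ?inordK //; lia.
    have [->|x6] := eqVneq (nat_of_ord x) 5%N;
      first by exists (inord 5); rewrite /= ?inordK //; lia.
    exists (inord x.+1) => //.
    by rewrite /= inordK //; case: (nat_of_ord x) x3 x4 x5 x6 => [|[|[|[|[|[|k]]]]]].
  - by exists (inord 2) => //; rewrite /= inordK //; lia.
  - by exists (inord 3) => //; rewrite /= inordK //; lia.
have leaf k : (2 < k)%N -> (k < n)%N ->
    pair n 2 k \in [set pair n 2 (val x) | x : 'I_n & 3 <= val x]%N.
  by move=> k3 kn; apply/imsetP; exists (Ordinal kn); rewrite // inE.
case: i lti => [|[|[|[|[|[|[|i]]]]]]] lti;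
  rewrite !inE ?eqxx ?orbT ?leaf ?orbT //=; lia.
Qed.

Lemma B2_5E :
  B2 5 = [set pair 5 (B2_5_pair (val i)).1 (B2_5_pair (val i)).2 | i : 'I_6].
Proof.
apply/setP => A; apply/idP/imsetP => [|[[i lti] _ ->]].
  rewrite !inE -!orbA => /or4P[/eqP->|/eqP->|/imsetP[x x3 ->]|/orP[]/eqP->].
  - by exists (inord 0) => //; rewrite /= inordK.
  - by exists (inord 1) => //; rewrite /= inordK.
  - rewrite inE /= in x3; have xn := ltn_ord x; exists (inord x.+1) => //.
    by rewrite /= inordK //; case: (nat_of_ord x) x3 => [|[|[|k]]].
  - by exists (inord 2) => //; rewrite /= inordK.
  - by exists (inord 3) => //; rewrite /= inordK.
have leaf k : (2 < k)%N -> (k < 5)%N ->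
    pair 5 2 k \in [set pair 5 2 (val x) | x : 'I_5 & 3 <= val x]%N.
  by move=> k3 kn; apply/imsetP; exists (Ordinal kn); rewrite // inE.
by case: i lti => [|[|[|[|[|[|i]]]]]] lti; rewrite !inE ?eqxx ?orbT ?leaf ?orbT.
Qed.

(** For concrete arguments the hypothesis is a closed boolean, settled by evaluation. *)
Lemma steiner4_table (g : nat -> nat * nat) rows p q :
  all (fun i => all (fun j => steiner4 (g i) (g j) == table rows i j) (iota 0 q))
    (iota 0 p) ->
  forall i j, (i < p)%N -> (j < q)%N -> steiner4 (g i) (g j) = table rows i j.
Proof.
move=> /allP h i j ip jq; apply/eqP; move: j jq.
have /h/allP hi : i \in iota 0 p by rewrite mem_iota.
by move=> j jq; apply: hi; rewrite mem_iota.
Qed.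

Lemma steiner4_leaves k l : (2 < k)%N -> (2 < l)%N ->
  steiner4 (2%N, k) (2%N, l) = (2 - (k == l))%N.
Proof.
case: k l => [|[|[|k]]] [|[|[|l]]] // _ _; rewrite /steiner4 /hull /= !inE /= !eqxx /=.
by rewrite !eqSS [l == k]eq_sym; case: eqVneq => [->|kl];
  rewrite /= ?orbF ?inE ?eqSS /= ?eqxx ?(negPf kl).
Qed.

(** The twin condition for e_{5+k} against e_4: columns below 6 are computed, and from 6 on both
    pairs are leaf edges. *)
Lemma B1_twins k j :
  (steiner4 (B1_pair (6 + k)) (B1_pair j))%:Z =
  (steiner4 (B1_pair 5) (B1_pair j))%:Z + (j == 5)%:R - (j == 6 + k)%N%:R.
Proof.
rewrite !addSn add0n.
case: j => [|[|[|[|[|[|j]]]]]]; last first.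
  by rewrite !steiner4_leaves // !eqSS eq_sym; case: eqP.
all: by rewrite /steiner4 /hull /= ?inE ?eqxx.
Qed.

Lemma B1_leaf_col i k : (i < 6)%N ->
  steiner4 (B1_pair i) (B1_pair (6 + k)) = tabB1 i 6.
Proof.
rewrite !addSn add0n; case: i => [|[|[|[|[|[|i]]]]]] // _.
all: by rewrite /steiner4 /hull /= ?inE ?eqxx.
Qed.

Lemma B2_twins k j :
  (steiner4 (B2_pair (7 + k)) (B2_pair j))%:Z =
  (steiner4 (B2_pair 5) (B2_pair j))%:Z + (j == 5)%:R - (j == 7 + k)%N%:R.
Proof.
rewrite !addSn add0n.
case: j => [|[|[|[|[|[|[|j]]]]]]]; last first.
  by rewrite !steiner4_leaves // !eqSS eq_sym; case: eqP.
all: by rewrite /steiner4 /hull /= ?inE ?eqxx.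
Qed.

Lemma B2_leaf_col i k : (i < 7)%N ->
  steiner4 (B2_pair i) (B2_pair (7 + k)) = tabB2 i 7.
Proof.
rewrite !addSn add0n; case: i => [|[|[|[|[|[|[|i]]]]]]] // _.
all: by rewrite /steiner4 /hull /= ?inE ?eqxx.
Qed.

Lemma polyC_natz (m : nat) : (m%:Z)%:P = m%:R :> {poly int}.
Proof. by rewrite -natz rmorph_nat. Qed.

(** * The three characteristic polynomials and the conclusion *)

Lemma char_poly_B1 N :
  char_poly (D2sub (@S1rel N.+4.+1) (B1 N.+4.+1)) =
  ('X + 1) ^+ N * ('X^6 - \sum_(j < 6) (nth 0 [:: 4 + N; 37 + 13 * N; 115 + 45 * N;
     144 + 54 * N; 69 + 21 * N; 8 + 2 * N] j)%N%:R *: 'X^j).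
Proof.
rewrite (char_poly_S1 _ _ _ (B1E _)) //; first last.
- by case=> [|[|[|[|i]]]] [|[|[|[|j]]]] //= _ _; move=> -[] *; lia.
- by case=> [|[|[|[|i]]]] //= h; lia.
rewrite (@char_poly_twins _ 6 N 5) // => [|k j _ _]; last exact: B1_twins.
rewrite mulrC; congr (_ * _).
rewrite char_poly_nat_mx -det_nat_mx.
have tab i j : (i < 6)%N -> (j < 7)%N -> steiner4 (B1_pair i) (B1_pair j) = tabB1 i j.
  exact: steiner4_table.
under eq_nat_mx => i j i6 j6.
  under eq_bigr do rewrite B1_leaf_col //.
  rewrite tab ?(leqW j6) // sumr_const card_ord -[_ *+ N]mulr_natr.
  rewrite polyCD !polyCM !polyC_natz !rmorph_nat.
  over.
rewrite det_nat_mx laplace_B1 !big_ord_recr big_ord0 /= -!mul_polyC !rmorph_nat.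
by ring.
Qed.

Lemma char_poly_B2 N :
  char_poly (D2sub (@S1rel N.+4.+2) (B2 N.+4.+2)) =
  ('X + 1) ^+ N.+1 * ('X^6 - \sum_(j < 6) (nth 0 [:: 5 + N; 56 + 15 * N; 185 + 53 * N;
     231 + 62 * N; 104 + 21 * N; 10 + 2 * N] j)%N%:R *: 'X^j).
Proof.
rewrite (char_poly_S1 _ _ _ (B2E _)) //; first last.
- by case=> [|[|[|[|[|[|[|i]]]]]]] [|[|[|[|[|[|[|j]]]]]]] //= _ _; move=> -[] *; lia.
- by case=> [|[|[|[|[|[|[|i]]]]]]] //= h; lia.
(* First e_6, e_7, ... are merged into e_5, giving (X+1)^(n-6). *)
rewrite (@char_poly_twins _ 7 N 5) // => [|k j _ _]; last exact: B2_twins.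
have tab i j : (i < 7)%N -> (j < 8)%N -> steiner4 (B2_pair i) (B2_pair j) = tabB2 i j.
  exact: steiner4_table.
under eq_nat_mx => i j i7 j7.
  under eq_bigr do rewrite B2_leaf_col //.
  rewrite tab ?(leqW j7) // sumr_const card_ord -[_ *+ N]mulr_natr.
  over.
(* Merging e_4 into e_3 supplies one more factor X+1. *)
rewrite (@char_poly_twins _ 6 1 4) // => [|k j k1 j7]; last first.
  rewrite (_ : k = 0)%N //; last by case: k k1.
  by case: j j7 => [|[|[|[|[|[|[|j]]]]]]] // _; rewrite /tabB2 /table /=; ring.
rewrite -mulrA -exprD add1n mulrC; congr (_ * _).
rewrite char_poly_nat_mx -det_nat_mx.
under eq_nat_mx => i j i6 j6.
  rewrite big_ord1 mul0r addr0 !polyCD !polyCM !polyC_natz !rmorph_nat.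
  over.
rewrite det_nat_mx laplace_B2 !big_ord_recr big_ord0 /= -!mul_polyC !rmorph_nat.
by ring.
Qed.

Lemma char_poly_B2_5 :
  char_poly (D2sub (@S1rel 5) (B2 5)) =
  ('X + 1) ^+ 0 *
  ('X^6 - \sum_(j < 6) (nth 0 [:: 4; 41; 132; 169; 83; 8] j)%N%:R *: 'X^j).
Proof.
rewrite (char_poly_S1 _ _ _ B2_5E) //; first last.
- by case=> [|[|[|[|i]]]] [|[|[|[|j]]]] //= _ _; move=> -[] *; lia.
- by case=> [|[|[|[|i]]]] //= h; lia.
rewrite char_poly_nat_mx -det_nat_mx.
have tab i j : (i < 6)%N -> (j < 6)%N ->
    steiner4 (B2_5_pair i) (B2_5_pair j) = tabB2_5 i j.
  exact: steiner4_table.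
under eq_nat_mx do rewrite tab // polyC_natz.
rewrite det_nat_mx laplace_B2_5 !big_ord_recr big_ord0 /= -!mul_polyC !rmorph_nat.
by ring.
Qed.

Theorem theorem5p6 (n : nat) (hn : (5 <= n)%N) :
  (forall t : nat, (t <= n.+1)%N ->
     (forall k : nat, (k <= n.+1)%N ->
        `|(char_poly (D2sub (@S1rel n) (B1 n)))`_k| <=
        `|(char_poly (D2sub (@S1rel n) (B1 n)))`_t|) ->
     ((n - 4)./2 <= t <= (n + 5)./2)%N) /\
  (forall t : nat, (t <= n.+1)%N ->
     (forall k : nat, (k <= n.+1)%N ->
        `|(char_poly (D2sub (@S1rel n) (B2 n)))`_k| <=
        `|(char_poly (D2sub (@S1rel n) (B2 n)))`_t|) ->
     ((n - 4)./2 <= t <= (n + 5)./2)%N).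
Proof.
case: n hn => [|[|[|[|[|N]]]]] // _; split.
  by rewrite char_poly_B1; apply: mode_boundedP => //=; lia.
(* For n = 5 the edge e_5, to which the general enumeration of B_2 gives index 5, does not exist. *)
case: N => [|N]; first by rewrite char_poly_B2_5; apply: mode_boundedP.
by rewrite char_poly_B2; apply: mode_boundedP => //=; lia.
Qed.
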